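(* Let $Q$ be a non-projection idempotent in a $C^*$-algebra with $\|Q\|=r$. Then $Q$ is a universal $r$-idempotent if and only if for every non-projection idempotent $Q'$ in any $C^*$-algebra satisfying $\|Q'\|\le r$, there exists a $C^*$-algebra homomorphism $\pi:C^*\{Q\}\to C^*\{Q'\}$ such that $$\pi\big(m(Q)\big)=m(Q')\quad\text{and}\quad \pi\big(P_{\mathcal{R}(Q)}\big)=P_{\mathcal{R}(Q')}.$$
   Context: An idempotent $Q$ in a $C^*$-algebra satisfies $Q^2=Q$; a projection is a self-adjoint idempotent; a non-projection idempotent is an idempotent that is not a projection (it has norm $>1$). $C^*\{Q\}$ is the $C^*$-algebra generated by $Q$ alone (not assumed to contain a unit of the ambient algebra). Universal $r$-idempotent ($r>1$): a non-projection idempotent $Q$ in a $C^*$-algebra such that $\|Q\|=r$ and for every non-projection idempotent $Q'$ in any $C^*$-algebra with $\|Q'\|\le r$ there is a $C^*$-algebra homomorphism ($*$-homomorphism) $\pi:C^*\{Q\}\to C^*\{Q'\}$ with $\pi(Q)=Q'$. Every $C^*$-algebra is regarded as a $C^*$-subalgebra of $\mathbb{B}(K)$ for some Hilbert space $K$, so idempotents are regarded as Hilbert space operators. For an idempotent $Q\in\mathbb{B}(K)$, $P_{\mathcal{R}(Q)}$ is the orthogonal projection onto the range of $Q$, and the matched projection is $m(Q)=\frac12(|Q^*|+Q^* )|Q^*|^\dag(|Q^*|+I)^{-1}(|Q^*|+Q)$, with $|T|=(T^*T)^{1/2}$ and $\dag$ the Moore-Penrose inverse. Both $m(Q)$ and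 $P_{\mathcal{R}(Q)}$ belong to $C^*\{Q\}$. *)

(* Defs.v *)
From HB Require Import structures.
From mathcomp Require Import all_boot all_order all_algebra sesquilinear.
From mathcomp Require Import complex.
From mathcomp Require Import all_classical all_reals all_analysis.

Set Implicit Arguments.
Unset Strict Implicit.
Unset Printing Implicit Defensive.

Import Order.TTheory GRing.Theory Num.Theory.
Import numFieldNormedType.Exports.

Local Open Scope classical_set_scope.
Local Open Scope complex_scope.
Local Open Scope ring_scope.

(* The form [hdot] is linear in its first argument and conjugate-linear in its
   second one; norms take their values in [R[i]], hence so does the equation. *)
HB.mixin Record CompleteNormedModule_isHilbert (R : realType) H
    & CompleteNormedModule R[i] H := {
  hdot : {dot H for (@Num.conj R[i])} ;
  normr_hdot : forall x : H, `|x| ^+ 2 = hdot x x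
}.

#[short(type="hilbertType")]
HB.structure Definition Hilbert (R : realType) :=
  {H of CompleteNormedModule R[i] H & CompleteNormedModule_isHilbert R H}.

Section Operators.
Context {R : realType} {H : hilbertType R}.
Implicit Types (S T A B X P Q : H -> H) (V : set H).

Definition bounded_op T : Prop :=
  linear T /\ exists M : R[i], forall x, `|T x| <= M * `|x|.

Definition opnorm T : R :=
  sup [set complex.Re `|T x| | x in [set x : H | `|x| <= 1]].

(* The operators below which are characterized by a property are obtained by
   choice, with the junk value [0] when there is no such operator. For bounded
   operators each of these properties has at most one solution. *)

Definition adjoint T : H -> H :=
  xget 0 [set S | bounded_op S /\ forall x y, hdot (T x) y = hdot x (S y)].

Definition positive_op T : Prop :=
  [/\ bounded_op T, adjoint T = T & forall x, 0 <= hdot (T x) x].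

Definition opsqrt T : H -> H :=
  xget 0 [set S | positive_op S /\ S \o S = T].

Definition opabs T : H -> H := opsqrt (adjoint T \o T).

Definition mp_inverse T : H -> H :=
  xget 0 [set X | [/\ bounded_op X, T \o X \o T = T, X \o T \o X = X,
                      adjoint (T \o X) = T \o X & adjoint (X \o T) = X \o T]].

Definition opinv T : H -> H :=
  xget 0 [set X | [/\ bounded_op X, T \o X = id & X \o T = id]].

Definition idempotent_op Q : Prop := bounded_op Q /\ Q \o Q = Q.

Definition projection_op P : Prop := idempotent_op P /\ adjoint P = P.

Definition nonprojection_idempotent Q : Prop :=
  idempotent_op Q /\ ~ projection_op Q.

Definition orthogonal_projection V : H -> H :=
  xget 0 [set P | projection_op P /\ range P = V].

Definition range_projection T : H -> H := orthogonal_projection (range T).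

Definition matched_projection Q : H -> H :=
  let Qs := adjoint Q in
  2^-1 *: ((opabs Qs + Qs) \o mp_inverse (opabs Qs)
             \o opinv (opabs Qs + id) \o (opabs Qs + Q)).

(* A C*-algebra is a norm-closed *-subalgebra of the bounded operators on a
   Hilbert space; it need not contain the identity operator. *)
Definition cstar_algebra (A : set (H -> H)) : Prop :=
  [/\ A `<=` bounded_op,
      A 0 /\ (forall S T, A S -> A T -> A (S + T)),
      (forall (c : R[i]) T, A T -> A (c *: T)) /\
        (forall S T, A S -> A T -> A (S \o T)),
      (forall T, A T -> A (adjoint T)) &
      (forall T, bounded_op T ->
         (forall e : R, 0 < e -> exists2 S, A S & opnorm (T - S) < e) -> A T)].

Definition cstar_generated Q : set (H -> H) := smallest cstar_algebra [set Q].

End Operators.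

(* Only the values of [phi] on [A] matter. *)
Definition cstar_morphism {R : realType} {H K : hilbertType R}
    (A : set (H -> H)) (B : set (K -> K)) (phi : (H -> H) -> (K -> K)) : Prop :=
  [/\ set_fun A B phi,
      forall S T, A S -> A T -> phi (S + T) = phi S + phi T,
      forall (c : R[i]) T, A T -> phi (c *: T) = c *: phi T,
      forall S T, A S -> A T -> phi (S \o T) = phi S \o phi T &
      forall T, A T -> phi (adjoint T) = adjoint (phi T)].

Definition universal_idempotent {R : realType} (r : R) {H : hilbertType R}
    (Q : H -> H) : Prop :=
  [/\ 1 < r, nonprojection_idempotent Q, opnorm Q = r &
      forall (K : hilbertType R) (B : set (K -> K)) (Q' : K -> K),
        cstar_algebra B -> B Q' ->
        nonprojection_idempotent Q' -> opnorm Q' <= r ->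
        exists pi : (H -> H) -> (K -> K),
          cstar_morphism (cstar_generated Q) (cstar_generated Q') pi /\
          pi Q = Q'].

(* Main.v *)
(* Let P be the range projection of the idempotent Q, S the absolute value of
   its adjoint, C the Moore-Penrose inverse of S and 1 - U the inverse of 1 + S.
   Then S C = C S = P, and P, S, C, U all lie in the C*-algebra generated by Q.
   The relations between them and Q determine them, so a *-homomorphism sending
   Q to Q' sends P, S, C, U to their analogues for Q', hence also M = m(Q), which
   is a polynomial in Q, its adjoint, S, C and U. Conversely, C = 2 P M P - P and
   Q = 2 S P M - S P: a *-homomorphism that respects P and M respects C, then S,
   which is the inverse of C relative to P, and finally Q. *)

Require Import Defs.
From HB Require Import structures.
From mathcomp Require Import all_boot all_order all_algebra sesquilinear.
From mathcomp Require Import complex.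
From mathcomp Require Import all_classical all_reals all_analysis.
From mathcomp Require Import ring lra.

Set Implicit Arguments.
Unset Strict Implicit.
Unset Printing Implicit Defensive.

Import Order.TTheory GRing.Theory Num.Theory.
Import numFieldNormedType.Exports.

Local Open Scope classical_set_scope.
Local Open Scope complex_scope.
Local Open Scope ring_scope.

(** * The underlying real inner product *)

(** Square roots and resolvents are therefore norm limits of iterations that start from 0 and stay
    in any C*-algebra containing the given operator; explicit error rates make membership part of
    the construction. Morphisms are purely algebraic maps with no continuity assumed, so nothing is
    transported through these limits. What passes to the image is a finite list of identities
    together with positivity, and positivity passes because a positive element is the square of a
    self-adjoint element of the same algebra. Since adjoints, absolute values, inverses and
    projections are chosen by a property, a candidate must be exhibited and shown unique before any
    formula for them can be used. *)

Section RealStructure.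
Context {R : realType} {H : hilbertType R}.
Implicit Types (x y z : H) (c : R).

(* All estimates are made with the real part of the form, which determines the
   form by [hdot_rdot]. *)
Definition rdot x y : R := complex.Re (hdot x y).
Definition nrm x : R := complex.Re `|x|.

Lemma normr_nrm x : `|x| = (nrm x)%:C.
Proof. by rewrite /nrm RRe_real// normr_real. Qed.

Lemma nrm_ge0 x : 0 <= nrm x.
Proof. by rewrite -ler0c -normr_nrm. Qed.

Lemma rdotC x y : rdot x y = rdot y x.
Proof.
rewrite /rdot [in LHS]hermC expr0 mul1r.
have ReJ (z : R[i]) : complex.Re (Num.conj z) = complex.Re z by case: z.
exact: ReJ.
Qed.

Lemma rdotDl x y z : rdot (x + y) z = rdot x z + rdot y z.
Proof. by rewrite /rdot linearDl raddfD. Qed.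

Lemma rdotNl x z : rdot (- x) z = - rdot x z.
Proof. by rewrite /rdot linearNl raddfN. Qed.

Lemma rdotZl c x z : rdot (c%:C *: x) z = c * rdot x z.
Proof.
by rewrite /rdot linearZl_LR/=; case: (hdot x z) => a b/=; rewrite mul0r subr0.
Qed.

Lemma rdotDr x y z : rdot z (x + y) = rdot z x + rdot z y.
Proof. by rewrite !(rdotC z) rdotDl. Qed.

Lemma rdotNr x z : rdot z (- x) = - rdot z x.
Proof. by rewrite !(rdotC z) rdotNl. Qed.

Lemma rdotZr c x z : rdot z (c%:C *: x) = c * rdot z x.
Proof. by rewrite !(rdotC z) rdotZl. Qed.

Lemma rdot0l z : rdot 0 z = 0.
Proof. by have := rdotNl 0 z; rewrite oppr0; lra. Qed.

Definition rdotE := (rdotDl, rdotDr, rdotNl, rdotNr, rdotZl, rdotZr, rdot0l).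

(** The imaginary part of a complex number [w] is the real part of [-i w], and the scalar [-i] can
    be moved into the linear first argument. *)
Lemma hdot_rdot x y : hdot x y = rdot x y +i* rdot ('i *: - x) y.
Proof.
rewrite /rdot linearZl_LR linearNl/=.
by case: (hdot x y) => a b/=; congr (_ +i* _); ring.
Qed.

Lemma nrm_sqr x : nrm x ^+ 2 = rdot x x.
Proof.
by rewrite /rdot -normr_hdot normr_nrm -rmorphXn.
Qed.

Lemma rdot_ge0 x : 0 <= rdot x x.
Proof. by rewrite -nrm_sqr sqr_ge0. Qed.

Lemma nrm_eq0 x : nrm x = 0 -> x = 0.
Proof. by move=> h; apply/normr0_eq0; rewrite normr_nrm h. Qed.

Lemma rdot_eq0 x : rdot x x = 0 -> x = 0.
Proof. by rewrite -nrm_sqr => /eqP; rewrite sqrf_eq0 => /eqP/nrm_eq0. Qed.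

Lemma rdot_inj x y : (forall z, rdot x z = rdot y z) -> x = y.
Proof.
move=> h; apply/eqP; rewrite -subr_eq0; apply/eqP/rdot_eq0.
by rewrite rdotDl rdotNl h subrr.
Qed.

Lemma nrmZ c x : nrm (c%:C *: x) = `|c| * nrm x.
Proof.
rewrite /nrm normrZ normr_nrm normc_def/= expr0n addr0 sqrtr_sqr.
by rewrite mulr0 subr0.
Qed.

Lemma nrmD x y : nrm (x + y) <= nrm x + nrm y.
Proof. by rewrite -lecR rmorphD/= -!normr_nrm ler_normD. Qed.

Lemma nrmN x : nrm (- x) = nrm x.
Proof. by rewrite /nrm normrN. Qed.

Lemma nrm0 : nrm (0 : H) = 0.
Proof. by rewrite /nrm normr0. Qed.

Lemma nrmB x y : nrm (x - y) <= nrm x + nrm y.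
Proof. by rewrite -(nrmN y) nrmD. Qed.

Lemma nrm_le c x : 0 <= c -> rdot x x <= c ^+ 2 -> nrm x <= c.
Proof. by rewrite -nrm_sqr => c0; rewrite ler_sqr// nnegrE nrm_ge0. Qed.

Lemma cauchy_schwarz x y : `|rdot x y| <= nrm x * nrm y.
Proof.
have [y0|yn0] := eqVneq (nrm y) 0.
  by rewrite y0 (nrm_eq0 y0) rdotC rdot0l normr0 mulr0.
have [x0|xn0] := eqVneq (nrm x) 0.
  by rewrite x0 (nrm_eq0 x0) rdot0l normr0 mul0r.
have y0 : 0 < nrm y by rewrite lt_def yn0 nrm_ge0.
have x0 : 0 < nrm x by rewrite lt_def xn0 nrm_ge0.
(* Expanding the square of [|y| x - e |x| y] gives the bound up to the factor [2 |x| |y|]; the signs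
   [e = 1] and [e = -1] give the two halves of the absolute value. *)
have h (e : R) : e ^+ 2 = 1 -> e * rdot x y <= nrm x * nrm y.
  move=> e1; have := rdot_ge0 ((nrm y)%:C *: x - (e * nrm x)%:C *: y).
  rewrite !rdotE -!nrm_sqr (rdotC y x) => h.
  rewrite -(ler_pM2l (mulr_gt0 x0 y0)).
  have := congr1 (fun t => t * nrm x ^+ 2 * nrm y ^+ 2) e1.
  by move=> /=; lra.
have := h 1 (expr1n _ _); have := h (-1) (etrans (sqrrN _) (expr1n _ _)).
by rewrite ler_norml; lra.
Qed.
End RealStructure.

(** * Bounded operators and their limits with explicit rates *)

Section Completeness.
Context {R : realType} {H : hilbertType R}.
Implicit Types (x y z : H) (c : R) (T S : H -> H).

(** One index per tolerance is enough: the bounds [e n] it serves either control all later terms of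
    a sequence or concern a quantity independent of [n]. *)
Definition vanishing (e : nat -> R) := forall d, 0 < d -> exists n, e n < d.

Lemma cauchy_limit (u : nat -> H) (e : nat -> R) :
  (forall m n, (n <= m)%N -> nrm (u m - u n) <= e n) -> vanishing e ->
  exists l, forall n, nrm (l - u n) <= e n.
Proof.
move=> ue e0.
have posE (d : R[i]) : 0 < d -> 0 < complex.Re d /\ d = (complex.Re d)%:C.
  by rewrite ltcE/=; case: d => a b /= /andP[/eqP -> ->].
have /cauchy_cvg/cvg_ex[l ul] : cauchy (u @ \oo).
  apply: cauchy_exP => d /posE[d0 ->].
  have [n en] := e0 _ d0; exists (u n); exists n => // m /= nm.
  rewrite -ball_normE/= -opprB normrN normr_nrm ltcR.
  exact: le_lt_trans (ue _ _ nm) en.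
exists l => n; apply/ler_addgt0Pr => d d0.
have /cvgrPdist_lt/(_ d%:C) := ul; rewrite ltcR => /(_ d0) [N _ hN].
have := hN (maxn n N) (leq_maxr _ _); rewrite /= normr_nrm ltcR => h.
have := ue (maxn n N) n (leq_maxl _ _).
have -> : l - u n = (l - u (maxn n N)) + (u (maxn n N) - u n).
  by rewrite addrA subrK.
have := nrmD (l - u (maxn n N)) (u (maxn n N) - u n); lra.
Qed.

Lemma bounded_opP T : bounded_op T <->
  linear T /\ exists M : R, 0 <= M /\ forall x, nrm (T x) <= M * nrm x.
Proof.
split=> -[lT [M hM]]; split=> //; last first.
  by exists M%:C => x; rewrite !normr_nrm -rmorphM lecR hM.2.
exists `|complex.Re M|; split=> // x; have := hM x.
rewrite !normr_nrm lecE => /andP[_]; case: M {hM} => a b/=.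
rewrite mulr0 subr0 => /le_trans; apply.
by rewrite ler_wpM2r ?nrm_ge0// ler_norm.
Qed.

Lemma bounded_opW T M : linear T -> (forall x, nrm (T x) <= M * nrm x) ->
  bounded_op T.
Proof.
move=> lT hM; apply/bounded_opP; split=> //; exists `|M|; split=> // x.
by apply: le_trans (hM x) _; rewrite ler_wpM2r ?nrm_ge0// ler_norm.
Qed.

Section Linear.
Variable T : H -> H.
Hypothesis bT : bounded_op T.

Lemma opD x y : T (x + y) = T x + T y.
Proof. by have := bT.1 1 x y; rewrite !scale1r. Qed.

Lemma op0 : T 0 = 0.
Proof. by apply: (addrI (T 0)); rewrite -opD !addr0. Qed.

Lemma opZ (c : R[i]) x : T (c *: x) = c *: T x.
Proof. by have := bT.1 c x 0; rewrite op0 !addr0. Qed.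

Lemma opN x : T (- x) = - T x.
Proof. by rewrite -scaleN1r opZ scaleN1r. Qed.

Lemma opB x y : T (x - y) = T x - T y.
Proof. by rewrite opD opN. Qed.
End Linear.

Lemma nrm_opnorm T x : bounded_op T -> nrm (T x) <= opnorm T * nrm x.
Proof.
move=> bT; have [lT [M [M0 hM]]] := (bounded_opP T).1 bT.
have [->|x0] := eqVneq x 0.
  by have := hM 0; rewrite !nrm0 !mulr0.
have nx0 : 0 < nrm x.
  by rewrite lt_def nrm_ge0 andbT; apply: contraNneq x0 => /nrm_eq0 ->.
have -> : nrm (T x) = nrm (T ((nrm x)^-1%:C *: x)) * nrm x.
  by rewrite (opZ bT) nrmZ gtr0_norm ?invr_gt0// mulrAC mulVf ?mul1r// gt_eqF.
rewrite ler_pM2r//; apply: ub_le_sup; last first.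
  exists ((nrm x)^-1%:C *: x) => //=.
  by rewrite normr_nrm nrmZ gtr0_norm ?invr_gt0// mulVf ?gt_eqF.
exists M => _ [y /= y1 <-]; rewrite -/(nrm _).
have {}y1 : nrm y <= 1 by rewrite -lecR -normr_nrm.
by apply: le_trans (hM y) _; rewrite -[leRHS]mulr1 ler_wpM2l.
Qed.

Lemma opnorm_le T M : 0 <= M -> (forall x, nrm (T x) <= M * nrm x) ->
  opnorm T <= M.
Proof.
move=> M0 hM; apply: ge_sup.
  by exists (nrm (T 0)); exists 0 => //=; rewrite normr0.
move=> _ [y /= y1 <-]; rewrite -/(nrm _).
have {}y1 : nrm y <= 1 by rewrite -lecR -normr_nrm.
by apply: le_trans (hM y) _; rewrite -[leRHS]mulr1 ler_wpM2l.
Qed.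

Lemma bounded_id : bounded_op (@idfun H).
Proof. by apply: (@bounded_opW _ 1) => [//|x]; rewrite mul1r. Qed.

Lemma bounded0 : bounded_op (0 : H -> H).
Proof.
have z x : (0 : H -> H) x = 0 by [].
by apply: (@bounded_opW _ 0) => [c x y|x]; rewrite !z ?scaler0 ?addr0// mul0r nrm0.
Qed.

Lemma boundedD S T : bounded_op S -> bounded_op T -> bounded_op (S + T).
Proof.
move=> bS bT; apply: (@bounded_opW _ (opnorm S + opnorm T)) => [c x y|x].
  by rewrite !fctE (opD bS) (opD bT) (opZ bS) (opZ bT) scalerDr addrACA.
rewrite !fctE mulrDl (le_trans (nrmD _ _))// lerD// nrm_opnorm//.
Qed.

Lemma boundedZ (c : R[i]) T : bounded_op T -> bounded_op (c *: T).
Proof.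
move=> bT; split => [d x y|].
  by rewrite !fctE (opD bT) (opZ bT) scalerDr !scalerA mulrC.
exists (`|c| * (opnorm T)%:C) => x; rewrite fctE normrZ -mulrA.
by rewrite ler_wpM2l// !normr_nrm -rmorphM lecR nrm_opnorm.
Qed.

Lemma boundedN T : bounded_op T -> bounded_op (- T).
Proof. by move=> bT; rewrite -scaleN1r; exact: boundedZ. Qed.

Lemma boundedM S T : bounded_op S -> bounded_op T -> bounded_op (S \o T).
Proof.
move=> bS bT; have [lS [M [M0 hM]]] := (bounded_opP S).1 bS.
apply: (@bounded_opW _ (M * opnorm T)) => [c x y|x /=].
  by rewrite /= (opD bT) (opD bS) (opZ bT) (opZ bS).
by rewrite (le_trans (hM _))// -mulrA ler_wpM2l// nrm_opnorm.
Qed.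

Lemma vanishing_le0 (e : nat -> R) (t K : R) : vanishing e -> 0 <= K ->
  (forall n, t <= e n * K) -> t <= 0.
Proof.
move=> e0 K0 h; apply/ler_addgt0Pl => d d0; rewrite addr0.
have K1 : 0 < K + 1 by rewrite ltr_wpDl.
have [n] := e0 (d / (K + 1)) (divr_gt0 d0 K1); rewrite ltr_pdivlMr// => en.
by have := h n; have [] := leP 0 (e n); nra.
Qed.

Lemma operator_limit (u : nat -> H -> H) (e : nat -> R) :
  (forall n, bounded_op (u n)) ->
  (forall m n x, (n <= m)%N -> nrm (u m x - u n x) <= e n * nrm x) ->
  vanishing e ->
  exists2 T, bounded_op T & forall n x, nrm (T x - u n x) <= e n * nrm x.
Proof.
move=> bu ue e0.
have /choice[T hT] x : exists l, forall n, nrm (l - u n x) <= e n * nrm x.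
  apply: cauchy_limit => [m n|d d0]; first exact: ue.
  have [x0|x0] := eqVneq (nrm x) 0.
    by exists 0%N; rewrite x0 mulr0.
  have nx0 : 0 < nrm x by rewrite lt_def x0 nrm_ge0.
  have [n en] := e0 (d / nrm x) (divr_gt0 d0 nx0).
  by exists n; rewrite -ltr_pdivlMr.
exists T => //; apply: (@bounded_opW _ (e 0%N + opnorm (u 0%N))) => [c x y|x].
  apply/eqP; rewrite -subr_eq0; apply/eqP/nrm_eq0/eqP.
  rewrite eq_le nrm_ge0 andbT.
  apply: (vanishing_le0 (K := nrm (c *: x + y) + nrm (c *: x) + nrm y) e0) => [|n].
    by rewrite addr_ge0 ?addr_ge0 ?nrm_ge0.
  have -> : T (c *: x + y) - (c *: T x + T y) =
    (T (c *: x + y) - u n (c *: x + y)) - c *: (T x - u n x) - (T y - u n y).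
    rewrite (opD (bu n)) (opZ (bu n)) scalerBr; apply: rdot_inj => z; rewrite !rdotE; lra.
  have := hT (c *: x + y) n; have := hT y n.
  have : nrm (c *: (T x - u n x)) <= e n * nrm (c *: x).
    rewrite -lecR -normr_nrm rmorphM/= -normr_nrm !normrZ mulrCA.
    by rewrite ler_wpM2l// !normr_nrm -rmorphM lecR.
  have := nrmB (T (c *: x + y) - u n (c *: x + y) - c *: (T x - u n x)) (T y - u n y).
  have := nrmB (T (c *: x + y) - u n (c *: x + y)) (c *: (T x - u n x)).
  lra.
have := hT x 0%N; have := nrm_opnorm x (bu 0%N).
by have := nrmD (T x - u 0%N x) (u 0%N x); rewrite subrK; lra.
Qed.

End Completeness.

(** * Riesz representation and adjoints *)

Section Adjoint.
Context {R : realType} {H : hilbertType R}.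
Implicit Types (x y z : H) (c : R) (T S : H -> H).

Lemma vanishing_invS (c : R) : 0 <= c -> vanishing (fun n => c * n.+1%:R^-1).
Proof.
move=> c0 d d0; have c1 : 0 < c + 1 by rewrite ltr_wpDl.
have [n _] := near_infty_natSinv_lt (PosNum (divr_gt0 d0 c1)).
move=> /(_ n (leqnn n)) /=; rewrite ltr_pdivlMr// => p; exists n.
have : 0 < n.+1%:R^-1 :> R by rewrite invr_gt0.
by move: p; set i := n.+1%:R^-1; lra.
Qed.

(* The representing vector is the limit of any minimizing sequence of the
   functional |x|^2/2 - f x, which is Cauchy by the parallelogram law. *)
Lemma riesz (f : H -> R) (M : R) :
  (forall x y, f (x + y) = f x + f y) ->
  (forall c x, f (c%:C *: x) = c * f x) ->
  (forall x, `|f x| <= M * nrm x) ->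
  exists z, forall h, f h = rdot h z.
Proof.
move=> fD fZ fM.
pose J x := rdot x x / 2 - f x.
have Jge x : - (M ^+ 2 / 2) <= J x.
  have := fM x; rewrite ler_norml /J -nrm_sqr => /andP[_].
  have := sqr_ge0 (nrm x - M); nra.
have infJ : has_inf (range J).
  split; first by exists (J 0), 0.
  by exists (- (M ^+ 2 / 2)) => _ [x _ <-].
have dJ x : inf (range J) <= J x by apply: ge_inf; [exact: infJ.2|exists x].
set d := inf (range J) in dJ *.
pose e n : R := n.+1%:R^-1.
have e0 n : 0 < e n by rewrite invr_gt0.
have /choice[u hu] n : exists x, J x < d + e n ^+ 2.
  have [_ [x _ <-]] := inf_adherent (exprn_gt0 2 (e0 n)) infJ.
  by exists x.
have ele m n : (n <= m)%N -> e m <= e n.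
  by move=> nm; rewrite lef_pV2 ?posrE// ler_nat.
(* By the parallelogram law [|u m - u n|^2 = 4 (J (u m) + J (u n)) - 8 J ((u m + u n) / 2)], which
   is at most [8 (e n)^2]; the constant 3 comes from [8 <= 9]. *)
have [|z hz] := @cauchy_limit _ _ u (fun n => 3 * e n) _ (vanishing_invS (ler0n _ 3)).
  move=> m n nm; apply: nrm_le; first by rewrite mulr_ge0 ?ler0n ?ltW.
  have := dJ (2^-1%:C *: (u m + u n)); have := hu m; have := hu n.
  have := ele _ _ nm; have := e0 m; have := e0 n.
  rewrite /J fZ fD !rdotE (rdotC (u n) (u m)); nra.
exists z => h; apply/eqP; rewrite -subr_eq0 -normr_eq0 eq_le normr_ge0 andbT.
apply: (vanishing_le0 (K := nrm h) (vanishing_invS (ler0n _ 5))) => [|n].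
  exact: nrm_ge0.
have : `|rdot (u n) h - f h| <= 2 * e n * nrm h.
  have [h0|h0] := eqVneq (nrm h) 0.
    have fh0 : f h = 0 by have := fM h; rewrite h0 mulr0 normr_le0 => /eqP.
    by rewrite (nrm_eq0 h0) in fh0 *; rewrite fh0 rdotC rdot0l subrr normr0 nrm0 mulr0.
  have {}h0 : 0 < nrm h by rewrite lt_def h0 nrm_ge0.
  set a := rdot (u n) h - f h.
  have b0 : 0 < rdot h h by rewrite -nrm_sqr exprn_gt0.
  rewrite -ler_sqr ?nnegrE ?normr_ge0//; last first.
    by rewrite !mulr_ge0 ?ler0n ?nrm_ge0 ?ltW.
  rewrite real_normK ?num_real// !exprMn nrm_sqr.
  (* Along the line [u n + t h], [J] changes by [t a + t^2 |h|^2 / 2], which is smallest at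
     [t = - a / |h|^2]; near-minimality of [u n] then bounds [a]. *)
  have := dJ (u n + (- a / rdot h h)%:C *: h); have := hu n.
  rewrite /J fD fZ !rdotE (rdotC h (u n)).
  have -> : rdot (u n) h = a + f h by rewrite /a subrK.
  move=> h1 h2.
  have {h1 h2} : a ^+ 2 / rdot h h / 2 <= e n ^+ 2.
    move: h1 h2; set r := rdot h h; set s := - a / r.
    have sr : s * r = - a by rewrite /s divfK// gt_eqF.
    have -> : a ^+ 2 / r = a * - s by rewrite /s expr2 mulNr opprK mulrA.
    have -> : s * (s * r) = s * - a by rewrite sr.
    by lra.
  rewrite ler_pdivrMr// ler_pdivrMr// => h1.
  have : 0 <= e n ^+ 2 * rdot h h by rewrite mulr_ge0 ?rdot_ge0 ?sqr_ge0.
  by lra.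
have := cauchy_schwarz (z - u n) h; have := hz n; rewrite !rdotE (rdotC z h).
have := nrm_ge0 h; have := e0 n.
rewrite !ler_norml -/(e n) => en nh zn /andP[h1 h2] /andP[h3 h4].
by apply/andP; split; nra.
Qed.

Definition is_adjoint T S := forall x y, rdot (T x) y = rdot x (S y).

Lemma is_adjoint_hdot T S : bounded_op T ->
  is_adjoint T S <-> (forall x y, hdot (T x) y = hdot x (S y)).
Proof.
move=> bT; split=> TS x y; last by rewrite /rdot TS.
rewrite [LHS]hdot_rdot [RHS]hdot_rdot -TS; congr (_ +i* _).
by rewrite -TS (opZ bT) (opN bT).
Qed.

Lemma adjoint_ex T : bounded_op T -> exists2 S, bounded_op S & is_adjoint T S.
Proof.
move=> bT; have [_ [M [M0 hM]]] := (bounded_opP T).1 bT.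
have /choice[S hS] y : exists z, forall x, rdot (T x) y = rdot x z.
  apply: (@riesz _ (M * nrm y)) => [x x'|c x|x].
  - by rewrite (opD bT) rdotDl.
  - by rewrite (opZ bT) rdotZl.
  - rewrite (le_trans (cauchy_schwarz _ _))// mulrAC ler_wpM2r ?nrm_ge0//.
have TS : is_adjoint T S by move=> x y; exact: hS.
have hTS := (is_adjoint_hdot S bT).1 TS.
exists S => //; apply: (@bounded_opW _ _ _ M) => [c y y'|y].
  apply: rdot_inj => x; rewrite rdotC [RHS]rdotC /rdot -hTS.
  have hdotP u (v w : H) : hdot u (c *: v + w) = Num.conj c * hdot u v + hdot u w :> R[i].
    exact: linearPr.
  by rewrite hdotP (hdotP x (S y) (S y')) !hTS.
have : nrm (S y) ^+ 2 <= M * nrm (S y) * nrm y.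
  rewrite nrm_sqr -TS (le_trans (ler_norm _))// (le_trans (cauchy_schwarz _ _))//.
  by rewrite ler_wpM2r ?nrm_ge0.
have [->|Sy0] := eqVneq (nrm (S y)) 0; first by rewrite mulr_ge0 ?nrm_ge0.
have {}Sy0 : 0 < nrm (S y) by rewrite lt_def Sy0 nrm_ge0.
by rewrite mulrAC expr2 ler_pM2r.
Qed.

Lemma is_adjoint_inj T S S' : is_adjoint T S -> is_adjoint T S' -> S = S'.
Proof.
move=> h h'; apply/funext => y; apply: rdot_inj => x.
by rewrite rdotC -h h' rdotC.
Qed.

Lemma adjointP T : bounded_op T ->
  bounded_op (adjoint T) /\ is_adjoint T (adjoint T).
Proof.
move=> bT; have [S bS TS] := adjoint_ex bT.
have hTS := (is_adjoint_hdot S bT).1 TS.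
have [bA hA] : [set S | bounded_op S /\ forall x y, hdot (T x) y = hdot x (S y)]
  (adjoint T) by apply: (@xgetPex _ 0); exists S.
by split=> //; apply/is_adjoint_hdot.
Qed.

Lemma bounded_adjoint T : bounded_op T -> bounded_op (adjoint T).
Proof. by move=> /adjointP[]. Qed.

Lemma rdot_adjoint T x y : bounded_op T ->
  rdot (T x) y = rdot x (adjoint T y).
Proof. by move=> /adjointP[]. Qed.

Lemma adjoint_eq T S : bounded_op T -> is_adjoint T S -> adjoint T = S.
Proof. by move=> /adjointP[_ h] h'; exact: is_adjoint_inj h h'. Qed.

Lemma adjointK T : bounded_op T -> adjoint (adjoint T) = T.
Proof.
move=> bT; apply: adjoint_eq; first exact: bounded_adjoint.
by move=> x y; rewrite rdotC -rdot_adjoint// rdotC.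
Qed.

Lemma adjointM S T : bounded_op S -> bounded_op T ->
  adjoint (S \o T) = adjoint T \o adjoint S.
Proof.
move=> bS bT; apply: adjoint_eq; first exact: boundedM.
by move=> x y /=; rewrite !rdot_adjoint.
Qed.

Lemma self_adjointP T : bounded_op T ->
  adjoint T = T <-> (forall x y, rdot (T x) y = rdot x (T y)).
Proof.
move=> bT; split=> [TT x y|TT]; first by rewrite rdot_adjoint// TT.
exact: adjoint_eq.
Qed.

Lemma rdot_skew x y : rdot ('i *: - x) y = - rdot ('i *: - y) x.
Proof.
have ImJ (z : R[i]) : complex.Im (Num.conj z) = - complex.Im z by case: z.
have h u v : rdot ('i *: - u) v = complex.Im (hdot u v) by rewrite hdot_rdot.
by rewrite !h -ImJ; congr complex.Im; rewrite hermC expr0 mul1r.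
Qed.

(** Positivity in [R[i]] also asserts that [hdot (T x) x] is real. Symmetry provides this: by
    [rdot_skew] the imaginary part equals its own opposite. *)
Lemma positive_opP T : positive_op T <->
  [/\ bounded_op T, forall x y, rdot (T x) y = rdot x (T y) &
      forall x, 0 <= rdot (T x) x].
Proof.
split=> [[bT sT pT]|[bT sT pT]].
  split=> //; first by apply/self_adjointP.
  by move=> x; have := pT x; rewrite lecE => /andP[].
split=> //; first by apply/self_adjointP.
move=> x; rewrite hdot_rdot lecE/= pT andbT.
have : rdot ('i *: - T x) x = - rdot ('i *: - T x) x.
  by rewrite {1}rdot_skew -sT (opZ bT) (opN bT).
by move=> h; apply/eqP; lra.
Qed.

End Adjoint.

(** * Square roots and resolvents of positive operators *)

Section CstarAlgebra.
Context {R : realType} {H : hilbertType R}.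
Implicit Types (x y z : H) (c : R) (T S B U : H -> H).

Section Closure.
Variable A : set (H -> H).
Hypothesis hA : cstar_algebra A.

Lemma cstar_bounded T : A T -> bounded_op T.
Proof. by case: hA => h _ _ _ _; exact: h. Qed.

Lemma cstar0 : A 0.
Proof. by case: hA => _ []. Qed.

Lemma cstarD S T : A S -> A T -> A (S + T).
Proof. by case: hA => _ [_ h] _ _ _; exact: h. Qed.

Lemma cstarZ (c : R[i]) T : A T -> A (c *: T).
Proof. by case: hA => _ _ [h _] _ _; exact: h. Qed.

Lemma cstarM S T : A S -> A T -> A (S \o T).
Proof. by case: hA => _ _ [_ h] _ _; exact: h. Qed.

Lemma cstar_adjoint T : A T -> A (adjoint T).
Proof. by case: hA => _ _ _ h _; exact: h. Qed.

Lemma cstarB S T : A S -> A T -> A (S - T).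
Proof. by move=> AS AT; apply: cstarD => //; rewrite -scaleN1r; apply: cstarZ. Qed.

Lemma cstar_limit T (u : nat -> H -> H) (e : nat -> R) :
  bounded_op T -> (forall n, A (u n)) -> (forall n, 0 <= e n) ->
  (forall n x, nrm (T x - u n x) <= e n * nrm x) -> vanishing e -> A T.
Proof.
move=> bT Au e0 uT ve; case: hA => _ _ _ _; apply => // d /ve[n en].
by by exists (u n) => //; apply: le_lt_trans en; apply: opnorm_le => // x; exact: uT.
Qed.
End Closure.

Definition commute_op B T := forall x, B (T x) = T (B x).

(** A bound on the quadratic form becomes a bound on the norm without square roots, whose
    construction relies on it. Positivity of [X] at [q x - X x] and the form bound at [X x] give
    [|X x|^2 <= q <X x, x>]. *)
Lemma positive_le X (q : R) x : positive_op X -> 0 < q ->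
  (forall x, rdot (X x) x <= q * rdot x x) -> nrm (X x) <= q * nrm x.
Proof.
move=> /positive_opP[bX sX pX] q0 Xq.
apply: nrm_le; first by rewrite mulr_ge0 ?nrm_ge0 ?ltW.
rewrite exprMn nrm_sqr.
have h : rdot (X x) (X x) <= q * rdot (X x) x.
  have := pX (q%:C *: x - X x); have := Xq (X x).
  rewrite !(opB bX) !(opZ bX) !rdotE (sX (X x) x) => h1 h2.
  rewrite -(ler_pM2l q0); lra.
by have := Xq x; nra.
Qed.

(* For 0 <= T <= 1, the defect Y = 1 - sqrt T is the limit of
   Y_(n+1) = (1 - T + Y_n^2) / 2, and s_(n+1) = (1 + s_n^2) / 2 bounds the norm
   of Y_n. The iterates below are W_n = s_n - Y_n: unlike Y_n, they lie in a
   possibly non-unital algebra containing T. *)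
Fixpoint sqrt_scalar (n : nat) : R :=
  if n is m.+1 then (1 + sqrt_scalar m ^+ 2) / 2 else 0.

Fixpoint sqrt_iter T (n : nat) : H -> H :=
  if n is m.+1 then
    (2^-1 : R)%:C *: (T + (2 * sqrt_scalar m)%:C *: sqrt_iter T m
                      - (sqrt_iter T m \o sqrt_iter T m))
  else 0.

(** For [t = 1 - s_n] the recursion reads [t -> t - t^2 / 2], increasing on [[0, 1]]; hence a decay
    of order [2 / n], the rate behind all estimates for the square root. *)
Lemma sqrt_scalar_bounds n : [/\ 0 <= sqrt_scalar n, sqrt_scalar n <= 1 &
  1 - sqrt_scalar n <= 2 * n.+2%:R^-1].
Proof.
elim: n => [|n [h0 h1 h2]] /=; first by rewrite divff// ?subr0 ?lexx ?ler01.
set s := sqrt_scalar n in h0 h1 h2 *.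
split; [nra|nra|].
set i : R := n.+2%:R^-1 in h2.
have n0 : 0 < n.+2%:R :> R by rewrite ltr0n.
have n3 : n.+3%:R = n.+2%:R + 1 :> R by rewrite -natr1.
have ni : i * n.+2%:R = 1 by rewrite mulVf ?gt_eqF.
have i1 : i <= 2^-1 by rewrite lef_pV2 ?posrE// ler_nat.
have i0 : 0 < i by rewrite invr_gt0.
rewrite ler_pdivlMr ?n3 ?addr_gt0//.
have : 1 - (1 + s ^+ 2) / 2 <= 2 * i * (1 - i) by nra.
move: ni n0; set k := n.+2%:R => ni k0 h3.
apply: le_trans (_ : 2 * i * (1 - i) * (k + 1) <= _); first by rewrite ler_pM2r ?addr_gt0.
have -> : 2 * i * (1 - i) * (k + 1) = 2 * (1 - i) * (i * k + i) by ring.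
rewrite ni; nra.
Qed.

Lemma sqrt_scalar_le m n : (n <= m)%N -> sqrt_scalar n <= sqrt_scalar m.
Proof.
elim: n m => [|n IH] [|m] //; first by move=> _; case: (sqrt_scalar_bounds m.+1).
rewrite ltnS => /IH /=; have [s0 _ _] := sqrt_scalar_bounds n; nra.
Qed.

Section SquareRoot.
Variables (A : set (H -> H)) (T : H -> H).
Hypotheses (hA : cstar_algebra A) (AT : A T) (pT : positive_op T).
Hypothesis T1 : forall x, rdot (T x) x <= rdot x x.

Local Notation W := (sqrt_iter T).
Local Notation s := sqrt_scalar.

Let bT : bounded_op T. Proof. exact: cstar_bounded AT. Qed.

Lemma sqrt_iterS n x : W n.+1 x =
  (2^-1 : R)%:C *: (T x + (2 * s n)%:C *: W n x - W n (W n x)).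
Proof. by []. Qed.

Lemma sqrt_iter_cstar n : A (W n).
Proof.
elim: n => [|n IH] /=; first exact: cstar0.
apply: (cstarZ hA); apply: (cstarB hA); last exact: (cstarM hA).
by apply: (cstarD hA) => //; exact: (cstarZ hA).
Qed.

Lemma sqrt_iter_bounded n : bounded_op (W n).
Proof. exact: cstar_bounded (sqrt_iter_cstar n). Qed.
Let bW := sqrt_iter_bounded.

Lemma sqrt_iter_sym n x y : rdot (W n x) y = rdot x (W n y).
Proof.
have /positive_opP[_ sT _] := pT.
elim: n x y => [|n IH] x y; first by rewrite /= rdot0l rdotC rdot0l.
by rewrite !sqrt_iterS !rdotE sT !IH.
Qed.

Lemma sqrt_iter_commute B n : bounded_op B -> commute_op B T -> commute_op B (W n).
Proof.
move=> bB BT; elim: n => [|n IH] x; first by rewrite /= (op0 bB).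
by rewrite !sqrt_iterS (opZ bB) (opB bB) (opD bB) (opZ bB) BT !IH.
Qed.

Definition sqrt_defect n x := (s n)%:C *: x - W n x.
Local Notation Y := sqrt_defect.

Lemma sqrt_defectS n x :
  Y n.+1 x = (2^-1 : R)%:C *: (x - T x + Y n (Y n x)).
Proof.
rewrite /Y sqrt_iterS (opB (bW n)) (opZ (bW n)); apply: rdot_inj => z.
by rewrite !rdotE /=; field.
Qed.

Lemma sqrt_defectB n x y : Y n (x - y) = Y n x - Y n y.
Proof.
by rewrite /Y (opB (bW n)); apply: rdot_inj => z; rewrite !rdotE; ring.
Qed.

Lemma nrm_sqrt_defect n x : nrm (Y n x) <= s n * nrm x.
Proof.
have /positive_opP[_ sT pT'] := pT.
have pX : positive_op (idfun - T).
  apply/positive_opP; split.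
  - by apply: boundedD; [exact: bounded_id|exact: boundedN].
  - by move=> u v; rewrite !fctE !rdotE sT.
  - by move=> u; rewrite !fctE !rdotE subr_ge0.
have hX u : nrm (u - T u) <= nrm u.
  rewrite -[leRHS]mul1r; apply: (@positive_le (idfun - T)) => // v.
  by rewrite !fctE !rdotE mul1r; have := pT' v; lra.
elim: n x => [|n IH] x; first by rewrite /Y /= scale0r subr0 nrm0 mul0r.
rewrite sqrt_defectS nrmZ gtr0_norm ?invr_gt0//.
have := nrmD (x - T x) (Y n (Y n x)); have := hX x.
have := IH x; have := IH (Y n x); have [s0 _ _] := sqrt_scalar_bounds n.
have := nrm_ge0 x => /=; nra.
Qed.

(** The scalar sequence majorizes increments as well: [Y_m^2 - Y_n^2 = Y_m (Y_m - Y_n) + (Y_m - Y_n)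
    Y_n], and the same factorization of [s_m^2 - s_n^2] turns the bound for [m, n] into the one for
    their successors. *)
Lemma nrm_sqrt_defectB m n x : (n <= m)%N ->
  nrm (Y m x - Y n x) <= (s m - s n) * nrm x.
Proof.
elim: n m x => [|n IH] [|m] x //.
- by rewrite subrr nrm0 subrr mul0r.
- move=> _; have := nrm_sqrt_defect m.+1 x.
  have -> : Y 0 x = 0 by rewrite /Y /= scale0r subr0.
  by rewrite !subr0.
rewrite ltnS => nm; rewrite !sqrt_defectS -scalerBr nrmZ gtr0_norm ?invr_gt0//.
have -> : x - T x + Y m (Y m x) - (x - T x + Y n (Y n x)) =
  Y m (Y m x - Y n x) + (Y m (Y n x) - Y n (Y n x)).
  rewrite (sqrt_defectB m (Y m x) (Y n x)).
  move: (Y m (Y m x)) (Y m (Y n x)) (Y n (Y n x)) => a b c.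
  by apply: rdot_inj => z; rewrite !rdotE; ring.
have := nrmD (Y m (Y m x - Y n x)) (Y m (Y n x) - Y n (Y n x)).
have := nrm_sqrt_defect m (Y m x - Y n x); have := IH m (Y n x) nm.
have := IH m x nm; have := nrm_sqrt_defect n x; have := nrm_ge0 x.
have [sm0 _ _] := sqrt_scalar_bounds m; have [sn0 _ _] := sqrt_scalar_bounds n.
have := sqrt_scalar_le nm; rewrite /=.
set a := nrm (Y m (Y m x - Y n x) + (Y m (Y n x) - Y n (Y n x))).
set b := nrm (Y m x - Y n x); set p := nrm (Y m (Y m x - Y n x)).
set q := nrm (Y n x); set t := nrm (Y m (Y n x) - Y n (Y n x)); set r := nrm x.
set u := s m; set v := s n => vu r0 h1 h2 h3 h4 h5.
have : p <= u * ((u - v) * r) by apply: le_trans h4 _; rewrite ler_wpM2l.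
have : t <= (u - v) * (v * r).
  by apply: le_trans h3 _; rewrite ler_wpM2l// subr_ge0.
lra.
Qed.

Lemma nrm_sqrt_iter n x : nrm (W n x) <= 2 * nrm x.
Proof.
have -> : W n x = (s n)%:C *: x - Y n x by rewrite /Y subKr.
have := nrmB ((s n)%:C *: x) (Y n x); have := nrm_sqrt_defect n x.
have [s0 s1 _] := sqrt_scalar_bounds n.
by rewrite nrmZ ger0_norm//; have := nrm_ge0 x; nra.
Qed.

(** The constant 4 is twice 2: the scalar increment and the defect increment are each at most
    [1 - s_n <= 2 / (n + 2)]. *)
Lemma nrm_sqrt_iterB m n x : (n <= m)%N ->
  nrm (W m x - W n x) <= 4 * n.+1%:R^-1 * nrm x.
Proof.
move=> nm; have -> : W m x - W n x = (s m - s n)%:C *: x - (Y m x - Y n x).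
  rewrite /Y; move: (W m x) (W n x) => a b.
  by apply: rdot_inj => z; rewrite !rdotE; ring.
apply: le_trans (nrmB _ _) _; have := nrm_sqrt_defectB x nm.
have sle := sqrt_scalar_le nm; rewrite nrmZ ger0_norm ?subr_ge0//.
have [_ s1 _] := sqrt_scalar_bounds m; have [_ _ sn] := sqrt_scalar_bounds n.
have : n.+2%:R^-1 <= n.+1%:R^-1 :> R by rewrite lef_pV2 ?posrE// ler_nat.
move: (n.+2%:R^-1) (n.+1%:R^-1) sn => i j sn ij.
by have := nrm_ge0 x; nra.
Qed.

Lemma sqrt_contraction : exists2 S, A S & [/\ positive_op S, S \o S = T &
  forall B, bounded_op B -> commute_op B T -> commute_op B S].
Proof.
pose e n : R := 4 * n.+1%:R^-1.
have ve : vanishing e := vanishing_invS (ler0n _ 4).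
have e0 n : 0 <= e n by rewrite mulr_ge0 ?ler0n ?invr_ge0.
have [S bS hS] := operator_limit bW nrm_sqrt_iterB ve.
have {}hS n x : nrm (S x - W n x) <= e n * nrm x := hS n x.
exists S; first exact: (cstar_limit hA bS sqrt_iter_cstar e0 hS ve).
split.
- apply/positive_opP; split=> // [x y|x].
    apply/eqP; rewrite -subr_eq0 -normr_le0.
    apply: (vanishing_le0 (K := 2 * (nrm x * nrm y)) ve) => [|n].
      by rewrite !mulr_ge0 ?nrm_ge0.
    have -> : rdot (S x) y - rdot x (S y) =
      rdot (S x - W n x) y - rdot x (S y - W n y).
      by rewrite !rdotE sqrt_iter_sym; ring.
    apply: le_trans (ler_normB _ _) _.
    apply: le_trans (lerD (cauchy_schwarz _ _) (cauchy_schwarz _ _)) _.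
    have := ler_wpM2r (nrm_ge0 y) (hS n x); have := ler_wpM2l (nrm_ge0 x) (hS n y).
    by move: (e n) => f; lra.
  rewrite -oppr_le0; apply: (vanishing_le0 (K := nrm x * nrm x) ve) => [|n].
    by rewrite !mulr_ge0 ?nrm_ge0.
  have : 0 <= rdot (W n x) x.
    have -> : W n x = (s n)%:C *: x - Y n x by rewrite /Y subKr.
    have := cauchy_schwarz (Y n x) x; have := nrm_sqrt_defect n x.
    rewrite ler_norml !rdotE -nrm_sqr => h /andP[_]; have := nrm_ge0 x; nra.
  have := cauchy_schwarz (S x - W n x) x; rewrite ler_norml => /andP[+ _].
  rewrite rdotDl rdotNl; have := ler_wpM2r (nrm_ge0 x) (hS n x); move: (e n) => f.
  by lra.
- apply/funext => x /=; apply/eqP; rewrite -subr_eq0; apply/eqP/nrm_eq0/eqP.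
  rewrite eq_le nrm_ge0 andbT.
  have [_ [M [M0 hM]]] := (bounded_opP S).1 bS.
  apply: (vanishing_le0 (K := (M + 6) * nrm x) ve) => [|n].
    by rewrite mulr_ge0 ?nrm_ge0// addr_ge0.
  (* The recursion solved for [T] gives [W_n^2 - T = -2 (W_(n+1) - W_n) + 2 (s_n - 1) W_n]. The four
     terms contribute [M], 2, 2 and 2 to the constant [M + 6]. *)
  have -> : S (S x) - T x = S (S x - W n x) + (S (W n x) - W n (W n x)) +
    ((-2)%:C *: (W n.+1 x - W n x) + (2 * (s n - 1))%:C *: W n x).
    rewrite sqrt_iterS (opB bS); move: (S (S x)) (S (W n x)) (W n (W n x)) (T x).
    by move=> a b c d; apply: rdot_inj => z; rewrite !rdotE; field.
  apply: le_trans (nrmD _ _) _.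
  have := nrmD (S (S x - W n x)) (S (W n x) - W n (W n x)).
  have := nrmD ((-2)%:C *: (W n.+1 x - W n x)) ((2 * (s n - 1))%:C *: W n x).
  have [_ s1 s2] := sqrt_scalar_bounds n.
  have : `|2 * (s n - 1)| <= e n.
    have : n.+2%:R^-1 <= n.+1%:R^-1 :> R by rewrite lef_pV2 ?posrE// ler_nat.
    by rewrite ler_norml /e; move: (n.+2%:R^-1) (n.+1%:R^-1) s2 => i j; lra.
  have := hM (S x - W n x); have := hS n x; have := hS n (W n x).
  have := nrm_sqrt_iter n x; have := nrm_sqrt_iterB x (leqnSn n).
  rewrite !nrmZ -/(e n) normrN (ger0_norm (ler0n _ 2)).
  have := normr_ge0 (2 * (s n - 1)); have := nrm_ge0 (W n x); have := e0 n.
  move: (e n) (`|2 * (s n - 1)|) (nrm (W n x)) (nrm x) => f g w v.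
  move: (nrm (S x - W n x)) (nrm (W n.+1 x - W n x)) => p q.
  move: (nrm (S (S x - W n x))) (nrm (S (W n x) - W n (W n x))) => k l.
  move: (nrm _) (nrm _) => m m' f0 w0 g0 h1 h2 h3 h4 h5 h6 h7 h8.
  have : M * p <= M * (f * v) by rewrite ler_wpM2l.
  have : g * w <= f * (2 * v) by rewrite ler_pM.
  have : f * w <= f * (2 * v) by rewrite ler_wpM2l.
  lra.
- move=> B bB BT x; apply/eqP; rewrite -subr_eq0; apply/eqP/nrm_eq0/eqP.
  rewrite eq_le nrm_ge0 andbT.
  have [_ [M [M0 hM]]] := (bounded_opP B).1 bB.
  apply: (vanishing_le0 (K := M * nrm x + nrm (B x)) ve) => [|n].
    by rewrite addr_ge0 ?nrm_ge0// mulr_ge0 ?nrm_ge0.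
  have -> : B (S x) - S (B x) = B (S x - W n x) - (S (B x) - W n (B x)).
    rewrite (opB bB) (sqrt_iter_commute n bB BT).
    move: (B (S x)) (S (B x)) (W n (B x)) => a b c.
    by apply: rdot_inj => z; rewrite !rdotE; ring.
  apply: le_trans (nrmB _ _) _; have := hM (S x - W n x).
  have : M * nrm (S x - W n x) <= M * (e n * nrm x) by rewrite ler_wpM2l.
  have := hS n (B x); lra.
Qed.

End SquareRoot.
End CstarAlgebra.

Section SquareRootInverse.
Context {R : realType} {H : hilbertType R}.
Implicit Types (x y z : H) (c : R) (T S B U : H -> H) (A : set (H -> H)).

Lemma cstar_bounded_op : cstar_algebra (@bounded_op R H).
Proof.
split=> //; first by split; [exact: bounded0|exact: boundedD].
- by split; [exact: boundedZ|exact: boundedM].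
- exact: bounded_adjoint.
Qed.

Lemma positive_sqrt A T : cstar_algebra A -> A T -> positive_op T ->
  exists2 S, A S & [/\ positive_op S, S \o S = T &
    forall B, bounded_op B -> commute_op B T -> commute_op B S].
Proof.
move=> hA AT pT; have /positive_opP[bT sT pT'] := pT.
have [_ [M [M0 hM]]] := (bounded_opP T).1 bT.
have c0 : 0 < M + 1 by rewrite ltr_wpDl.
have [| |x|S AS [pS SS cS]] := @sqrt_contraction _ _ A ((M + 1)^-1%:C *: T) hA.
- exact: cstarZ.
- apply/positive_opP; split; first exact: boundedZ.
    by move=> x y; rewrite !fctE !rdotE sT.
  by move=> x; rewrite fctE rdotE mulr_ge0// invr_ge0 ltW.
- rewrite fctE rdotE ler_pdivrMl//.
  have := ler_wpM2r (nrm_ge0 x) (hM x); have := cauchy_schwarz (T x) x.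
  by rewrite ler_norml -nrm_sqr => /andP[_]; have := sqr_ge0 (nrm x); lra.
have sc : Num.sqrt (M + 1) ^+ 2 = M + 1 by rewrite sqr_sqrtr// ltW.
have /positive_opP[bS sS pS'] := pS.
exists ((Num.sqrt (M + 1))%:C *: S); first exact: cstarZ.
split.
- apply/positive_opP; split; first exact: boundedZ.
    by move=> x y; rewrite !fctE !rdotE sS.
  by move=> x; rewrite fctE rdotE mulr_ge0// sqrtr_ge0.
- apply/funext => x /=; rewrite !fctE (opZ bS) scalerA -rmorphM/= -expr2 sc.
  rewrite -[S (S x)]/((S \o S) x) SS fctE scalerA -rmorphM/= divff ?gt_eqF//.
  by rewrite scale1r.
- move=> B bB BT x; rewrite !fctE (opZ bB) cS// => y.
  by rewrite !fctE (opZ bB) BT.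
Qed.

Lemma positive_rdot_eq0 T x : positive_op T -> rdot (T x) x = 0 -> T x = 0.
Proof.
move=> /positive_opP[bT sT pT] Tx0.
have [_ [M [M0 hM]]] := (bounded_opP T).1 bT.
have c0 : 0 < M + 1 by rewrite ltr_wpDl.
apply: rdot_eq0; apply/eqP; rewrite eq_le rdot_ge0 andbT.
(* As [<T x, x> = 0], this form value is [-2 (M + 1) |T x|^2 + <T (T x), T x>], at most
   [-(M + 2) |T x|^2]; being nonnegative, it forces [T x = 0]. *)
have := pT ((M + 1)%:C *: x - T x).
rewrite (opB bT) (opZ bT) !rdotE Tx0 (sT (T x) x).
have : rdot (T (T x)) (T x) <= M * rdot (T x) (T x).
  have := ler_wpM2r (nrm_ge0 (T x)) (hM (T x)).
  have := cauchy_schwarz (T (T x)) (T x).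
  by rewrite ler_norml -nrm_sqr => /andP[_]; lra.
by have := rdot_ge0 (T x); nra.
Qed.

(** Two given roots are not known to commute, so each is compared with the constructed root [Z],
    which commutes with whatever commutes with the square. For [d = X x - Z x], [(X + Z) d = 0]
    makes both forms vanish at [d]; so [X d = Z d = 0], and [|d|^2 = <x, (X - Z) d> = 0]. *)
Lemma positive_sqrt_inj S S' : positive_op S -> positive_op S' ->
  S \o S = S' \o S' -> S = S'.
Proof.
move=> pS pS' SS'.
have pT : positive_op (S \o S).
  have /positive_opP[bS sS _] := pS.
  apply/positive_opP; split; first exact: boundedM.
    by move=> x y /=; rewrite !sS.
  by move=> x /=; rewrite sS rdot_ge0.
have [Z _ [pZ ZZ cZ]] := positive_sqrt cstar_bounded_op (let: And3 h _ _ := pT in h) pT.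
have uniq X : positive_op X -> X \o X = S \o S -> X = Z.
  move=> pX XX; have /positive_opP[bX sX pX'] := pX.
  have /positive_opP[bZ sZ pZ'] := pZ.
  have XZ : commute_op X Z by apply: cZ => // x; rewrite -XX.
  have eqXZ x : X (X x) = Z (Z x).
    by rewrite -[LHS]/((X \o X) x) XX -ZZ.
  apply/funext => x; apply/eqP; rewrite -subr_eq0; apply/eqP.
  have sum0 u : rdot (X (X u - Z u)) (X u - Z u) + rdot (Z (X u - Z u)) (X u - Z u) = 0.
    rewrite -rdotDl (opB bX) (opB bZ) eqXZ XZ addrC subrKA subrr.
    by rewrite rdot0l.
  have := sum0 x; have := pX' (X x - Z x); have := pZ' (X x - Z x) => h1 h2 h3.
  have XD : X (X x - Z x) = 0 by apply: positive_rdot_eq0 => //; lra.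
  have ZD : Z (X x - Z x) = 0 by apply: positive_rdot_eq0 => //; lra.
  apply: rdot_eq0; rewrite {1}rdotDl rdotNl.
  by rewrite sX sZ XD ZD rdotC rdot0l subrr.
by rewrite (uniq S)// (uniq S').
Qed.

Lemma opsqrt_eq S T : positive_op S -> S \o S = T -> opsqrt T = S.
Proof.
move=> pS SS; apply: xget_unique => // S' [pS' SS'].
by apply: positive_sqrt_inj; rewrite // SS' SS.
Qed.

Lemma vanishing_geometric (q c : R) : 0 <= q < 1 -> 0 <= c ->
  vanishing (fun n => q ^+ n * c).
Proof.
move=> /andP[q0 q1] c0 d d0; have c1 : 0 < c + 1 by rewrite ltr_wpDl.
have /cvgrPdist_lt/(_ _ (divr_gt0 d0 c1))[n _ /(_ n (leqnn n))] :
  q ^+ n @[n --> \oo] --> 0 by apply: cvg_expr; rewrite ger0_norm.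
rewrite sub0r normrN ger0_norm ?exprn_ge0// ltr_pdivlMr// => h; exists n.
have : 0 <= q ^+ n by rewrite exprn_ge0.
by lra.
Qed.

Section Inverse.
Variables (A : set (H -> H)) (T : H -> H).
Hypotheses (hA : cstar_algebra A) (AT : A T) (pT : positive_op T).

(** Richardson iteration with step [1 / c] for the equation [(1 + T) U = T]. *)
Fixpoint resolvent_iter c (n : nat) : H -> H :=
  if n is m.+1 then
    let U := resolvent_iter c m in U - c^-1%:C *: (U + (T \o U) - T)
  else 0.

(* [id - U] inverts [id + T]; the identity itself need not lie in [A]. *)
Lemma resolvent : exists2 U, A U & [/\ forall x, U x + T (U x) = T x,
    forall x, U x + U (T x) = T x &
    forall B, bounded_op B -> commute_op B T -> commute_op B U].
Proof.
have /positive_opP[bT sT pT'] := pT.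
have [_ [M [M0 hM]]] := (bounded_opP T).1 bT.
(* As [0 <= T <= M] in the sense of forms, [G = 1 - (1 + T) / c] below lies between [i] and [1 - i]:
   the shift by 2 makes it positive and a strict contraction. *)
pose c := M + 2; have c0 : 0 < c by rewrite ltr_wpDl.
pose i := c^-1; have i0 : 0 < i by rewrite invr_gt0.
have ci : c * i = 1 by rewrite divff ?gt_eqF.
have i1 : i <= 2^-1 by rewrite lef_pV2 ?posrE// /c; lra.
pose W := resolvent_iter c.
have WS n x : W n.+1 x = W n x - i%:C *: (W n x + T (W n x) - T x) by [].
have AW n : A (W n).
  elim: n => [|n IH] /=; first exact: cstar0.
  apply: (cstarB hA) => //; apply: (cstarZ hA); apply: (cstarB hA) => //.
  by apply: (cstarD hA) => //; exact: (cstarM hA).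
have bW n := cstar_bounded hA (AW n).
have cW B n : bounded_op B -> commute_op B T -> commute_op B (W n).
  move=> bB BT; elim: n => [|n IH] x; first by rewrite /W /= (op0 bB).
  by rewrite !WS (opB bB) (opZ bB) (opB bB) (opD bB) BT !IH BT.
pose G x := x - i%:C *: (x + T x).
have Gle x : nrm (G x) <= (1 - i) * nrm x.
  apply: positive_le; [apply/positive_opP; split| |].
  - by apply: boundedD; [exact: bounded_id|apply: boundedN; apply: boundedZ;
      apply: boundedD; [exact: bounded_id|]].
  - by move=> u v; rewrite /G !rdotE sT.
  - move=> u; rewrite /G !rdotE.
    have := ler_wpM2r (nrm_ge0 u) (hM u); have := cauchy_schwarz (T u) u.
    rewrite ler_norml -nrm_sqr => /andP[_]; have := sqr_ge0 (nrm u).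
    move=> h1 h2 h3.
    have : rdot (T u) u <= M * nrm u ^+ 2 by lra.
    move=> /(ler_wpM2l (ltW i0)).
    have iM : i * M = 1 - 2 * i by have := ci; rewrite {1}/c mulrDl; lra.
    rewrite mulrA iM.
    by have := mulr_ge0 (ltW i0) h1; lra.
  - lra.
  - by move=> u; rewrite /G !rdotE; have := mulr_ge0 (ltW i0) (pT' u); lra.
have WB m n x : W m.+1 x - W n.+1 x = G (W m x - W n x).
  rewrite !WS /G (opB bT); move: (W m x) (W n x) => a b.
  by apply: rdot_inj => z; rewrite !rdotE; ring.
have W0 n x : nrm (W n x) <= M * nrm x.
  elim: n => [|n IH]; first by rewrite /W /= nrm0 mulr_ge0 ?nrm_ge0.
  have -> : W n.+1 x = G (W n x) + i%:C *: T x.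
    rewrite WS /G; move: (W n x) (T (W n x)) => a b.
    by apply: rdot_inj => z; rewrite !rdotE; ring.
  apply: le_trans (nrmD _ _) _; rewrite nrmZ gtr0_norm//.
  have := Gle (W n x); have := ler_wpM2l (ltW i0) (hM x).
  have : (1 - i) * nrm (W n x) <= (1 - i) * (M * nrm x).
    by rewrite ler_wpM2l// subr_ge0; lra.
  lra.
pose e n := (1 - i) ^+ n * M.
have q0 : 0 <= 1 - i by lra.
have ve : vanishing e by apply: vanishing_geometric => //; rewrite q0; lra.
have e0 n : 0 <= e n by rewrite mulr_ge0// exprn_ge0.
have We m n x : (n <= m)%N -> nrm (W m x - W n x) <= e n * nrm x.
  elim: n m => [|n IH] [|m] //= nm.
  - by rewrite subrr nrm0 mulr_ge0 ?nrm_ge0.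
  - by rewrite /e expr0 mul1r {2}/W /= subr0; exact: W0 m.+1 x.
  rewrite WB; apply: le_trans (Gle _) _.
  by rewrite /e exprS -!mulrA ler_wpM2l// mulrA; exact: IH.
have [U bU hU] := operator_limit bW We ve.
have limU y t K : 0 <= K -> (forall n, nrm (y - t) <= e n * K) -> y = t.
  move=> K0 h; apply/eqP; rewrite -subr_eq0; apply/eqP/nrm_eq0/eqP.
  by rewrite eq_le nrm_ge0 andbT; exact: (vanishing_le0 (K := K) ve).
have cU B : bounded_op B -> commute_op B T -> commute_op B U.
  move=> bB BT x; have [_ [N [N0 hN]]] := (bounded_opP B).1 bB.
  apply: (limU _ _ (N * nrm x + nrm (B x))) => [|n].
    by rewrite addr_ge0 ?nrm_ge0// mulr_ge0 ?nrm_ge0.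
  have -> : B (U x) - U (B x) = B (U x - W n x) - (U (B x) - W n (B x)).
    rewrite (opB bB) (cW _ n bB BT).
    move: (B (U x)) (U (B x)) (W n (B x)) => a b d.
    by apply: rdot_inj => z; rewrite !rdotE; ring.
  apply: le_trans (nrmB _ _) _; have := hN (U x - W n x).
  have : N * nrm (U x - W n x) <= N * (e n * nrm x) by rewrite ler_wpM2l.
  have := hU n (B x); move: (e n) => f; lra.
have UT x : U x + T (U x) = T x.
  apply: (limU _ _ ((2 * c + 1 + M) * nrm x)) => [|n].
    by rewrite mulr_ge0 ?nrm_ge0// !addr_ge0// mulr_ge0 ?ler0n ?ltW.
  (* The residual of [W n] in the equation is [- c] times the next increment, which the Cauchy
     estimate controls. *)
  have -> : U x + T (U x) - T x =
    (U x - W n x) + T (U x - W n x) - c%:C *: (W n.+1 x - W n x).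
    have -> : W n.+1 x - W n x = - (i%:C *: (W n x + T (W n x) - T x)).
      by rewrite WS addrAC subrr sub0r.
    rewrite (opB bT) scalerN scalerA -rmorphM/= ci scale1r.
    move: (W n x) (T (W n x)) (T (U x)) => a b d.
    by apply: rdot_inj => z; rewrite !rdotE; ring.
  apply: le_trans (nrmB _ _) _; rewrite nrmZ gtr0_norm//.
  have := nrmD (U x - W n x) (T (U x - W n x)); have := hM (U x - W n x).
  have := ler_wpM2l M0 (hU n x); have := ler_wpM2l (ltW c0) (We _ _ x (leqnSn n)).
  have := hU n x; have := mulr_ge0 (ltW c0) (mulr_ge0 (e0 n) (nrm_ge0 x)).
  move: (e n) => f; lra.
exists U; first exact: (cstar_limit hA bU AW e0 hU ve).
split=> // x; rewrite -[in RHS]UT; congr (_ + _).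
by rewrite -cU.
Qed.
End Inverse.
End SquareRootInverse.

(** * Range and matched projections of an idempotent *)

Section Idempotents.
Context {R : realType} {H : hilbertType R}.
Implicit Types (x y z : H) (c : R) (Q P S C U X M T : H -> H) (A : set (H -> H)).

Lemma eq_at T S : T = S -> forall x, T x = S x.
Proof. by move=> ->. Qed.

(** The inverse of [1 + S] enters only through [U], so each relation is an identity between elements
    of a possibly non-unital algebra, apart from boundedness and positivity. This form lets a
    *-homomorphism carry over the whole record. *)
Record polar_data Q P S C U : Prop := PolarData {
  polar_bounded : [/\ bounded_op Q, bounded_op P, bounded_op C & bounded_op U];
  polar_adjP : adjoint P = P;
  polar_PQ : P \o Q = Q;
  polar_QP : Q \o P = P;
  polar_pos : positive_op S;
  polar_sqr : S \o S = Q \o adjoint Q;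
  polar_SC : S \o C = P;
  polar_CS : C \o S = P;
  polar_CP : C \o P = C;
  polar_SU : U + (S \o U) = S;
  polar_US : U + (U \o S) = S }.

(** The adjoint of [P Q = Q] shows that [adjoint Q] kills [v = x - P x], and [|S v|^2] is the form
    of [Q (adjoint Q)] at [v]. *)
Lemma sqrt_range S P Q : positive_op S -> S \o S = Q \o adjoint Q ->
  bounded_op Q -> bounded_op P -> adjoint P = P -> P \o Q = Q -> S \o P = S.
Proof.
move=> /positive_opP[bS sS _] SS bQ bP /(self_adjointP bP) sP PQ.
have QsP x : adjoint Q (P x) = adjoint Q x.
  apply: rdot_inj => z; rewrite rdotC -rdot_adjoint// -sP [RHS]rdotC -rdot_adjoint//.
  by rewrite -[P (Q z)]/((P \o Q) z) PQ.
apply/funext => x /=; apply/eqP; rewrite -subr_eq0 -(opB bS); apply/eqP/rdot_eq0.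
rewrite sS -[S (S _)]/((S \o S) _) SS /= (opB (bounded_adjoint bQ)) QsP subrr.
by rewrite (op0 bQ) rdotC rdot0l.
Qed.

Section PolarData.
Variables (Q P S C U : H -> H).
Hypothesis hQ : polar_data Q P S C U.

Let bQ : bounded_op Q. Proof. by have [[]] := hQ. Qed.
Let bP : bounded_op P. Proof. by have [[]] := hQ. Qed.
Let bC : bounded_op C. Proof. by have [[]] := hQ. Qed.
Let bU : bounded_op U. Proof. by have [[]] := hQ. Qed.
Let bS : bounded_op S. Proof. by have /positive_opP[] := polar_pos hQ. Qed.
Let sP x y : rdot (P x) y = rdot x (P y).
Proof. exact: (self_adjointP bP).1 (polar_adjP hQ) x y. Qed.
Let sS x y : rdot (S x) y = rdot x (S y).
Proof. by have /positive_opP[_ h _] := polar_pos hQ; exact: h. Qed.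

Let PQ x : P (Q x) = Q x. Proof. exact: (eq_at (polar_PQ hQ)). Qed.
Let QP x : Q (P x) = P x. Proof. exact: (eq_at (polar_QP hQ)). Qed.
Let SS x : S (S x) = Q (adjoint Q x). Proof. exact: (eq_at (polar_sqr hQ)). Qed.
Let SC x : S (C x) = P x. Proof. exact: (eq_at (polar_SC hQ)). Qed.
Let CS x : C (S x) = P x. Proof. exact: (eq_at (polar_CS hQ)). Qed.
Let CP x : C (P x) = C x. Proof. exact: (eq_at (polar_CP hQ)). Qed.
Let SU x : U x + S (U x) = S x. Proof. exact: (eq_at (polar_SU hQ)). Qed.
Let US x : U x + U (S x) = S x. Proof. exact: (eq_at (polar_US hQ)). Qed.

Lemma polar_SP x : S (P x) = S x.
Proof.
exact: (eq_at (sqrt_range (polar_pos hQ) (polar_sqr hQ) bQ bP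
  (polar_adjP hQ) (polar_PQ hQ))).
Qed.
Let SP := polar_SP.

Lemma polar_PS x : P (S x) = S x.
Proof. by apply: rdot_inj => z; rewrite sP sS SP -sS. Qed.
Let PS := polar_PS.

Lemma polar_PP x : P (P x) = P x.
Proof. by rewrite -(QP x) PQ. Qed.
Let PP := polar_PP.

Lemma polar_PC x : P (C x) = C x.
Proof. by rewrite -CS SC CP. Qed.
Let PC := polar_PC.

Let PQs x : P (adjoint Q x) = P x.
Proof.
by apply: rdot_inj => z; rewrite sP rdotC -rdot_adjoint// QP rdotC -sP.
Qed.

Lemma range_projectionE : range_projection Q = P.
Proof.
apply: xget_unique.
  split; first by split; [split=> //; apply/funext => x; exact: PP|exact: polar_adjP hQ].
  apply/seteqP; split=> _ [x _ <-]; first by exists (P x); rewrite ?QP.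
  by exists (Q x); rewrite ?PQ.
move=> X [[[bX XX] sX] rX].
have {}sX := (self_adjointP bX).1 sX.
have XP x : X (P x) = P x.
  have : range X (P x) by rewrite rX; exists (P x); rewrite ?QP.
  by move=> [y _ <-]; exact: (eq_at XX).
have PX x : P (X x) = X x.
  have : range Q (X x) by rewrite -rX; exists x.
  by move=> [y _ <-].
by apply/funext => x; apply: rdot_inj => z; rewrite -PX sP sX XP -sP.
Qed.

Lemma opabs_adjoint : opabs (adjoint Q) = S.
Proof.
rewrite /opabs adjointK//; apply: opsqrt_eq; [exact: polar_pos hQ|exact: polar_sqr hQ].
Qed.

(** For a competitor [X], [S X P = S X S C = S C = P], while the adjoint of [P S X = S X] is
    [S X P = S X]. So [S X = P], likewise [X S = P], and [X = X S X = X P = X S C = P C = C]. *)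
Lemma mp_inverse_polar : mp_inverse S = C.
Proof.
apply: xget_unique.
  split=> //; try (apply/funext => x /=).
  - by rewrite SC PS.
  - by rewrite CS PC.
  - by rewrite (polar_SC hQ) (polar_adjP hQ).
  - by rewrite (polar_CS hQ) (polar_adjP hQ).
move=> X [bX SXS XSX sSX sXS].
have sr := (self_adjointP (boundedM bS bX)).1 sSX.
have sl := (self_adjointP (boundedM bX bS)).1 sXS.
have hSX x : S (X (S x)) = S x := eq_at SXS x.
have hX x : X (S (X x)) = X x := eq_at XSX x.
have SXP x : S (X x) = P x.
  have <- : S (X (P x)) = S (X x); last by rewrite -{1}SC hSX SC.
  apply: rdot_inj => z; have := sr (P x) z; rewrite /= => ->.
  by rewrite sP PS; have := sr x z; rewrite /= => ->.
have XSP x : X (S x) = P x.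
  have <- : P (X (S x)) = X (S x); last by rewrite -CS hSX CS.
  apply: rdot_inj => z; rewrite sP; have := sl x (P z); rewrite /= => ->.
  by rewrite SP; have := sl x z; rewrite /= => ->.
by apply/funext => x; rewrite -hX SXP -SC XSP PC.
Qed.

Let SE x : S (x - U x) + (x - U x) = x.
Proof.
rewrite (opB bS); apply: rdot_inj => z; rewrite !rdotE.
by have := congr1 (fun v => rdot v z) (SU x); rewrite rdotDl; lra.
Qed.

Let ES x : S x + x - U (S x + x) = x.
Proof.
rewrite (opD bU); apply: rdot_inj => z; rewrite !rdotE.
by have := congr1 (fun v => rdot v z) (US x); rewrite rdotDl; lra.
Qed.

Lemma opinv_polar : opinv (S + idfun) = idfun - U.
Proof.
apply: xget_unique.
  split; [|exact/funext|exact/funext].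
  by apply: boundedD; [exact: bounded_id|exact: boundedN].
move=> X [bX hSX hXS]; apply/funext => x; rewrite -{1}(SE x).
exact: (eq_at hXS (x - U x)).
Qed.

(** Distributing over [1 - U] removes the identity, so that every factor lies in the generated
    algebra and can be mapped by a morphism. *)
Lemma matched_projectionE : matched_projection Q =
  (2^-1)%:C *: (((S + adjoint Q) \o C \o (S + Q))
                - ((S + adjoint Q) \o C \o U \o (S + Q))).
Proof.
rewrite /matched_projection opabs_adjoint mp_inverse_polar opinv_polar.
have -> : (2^-1 : R)%:C = 2^-1 :> R[i] by rewrite fmorphV/= rmorphMn.
congr (_ *: _); apply/funext => x /=; rewrite !fctE /= (opB bC).
by rewrite (opB bS) (opB (bounded_adjoint bQ)); apply: rdot_inj => z; rewrite !rdotE; ring.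
Qed.

(** Since [P (adjoint Q) = P], the outer factor [S + adjoint Q] becomes [S + P], and
    [(S + P) C = P + C = C (S + 1)] cancels the inverse of [1 + S]. What remains is half of
    [C (S + Q) = P + C Q]. *)
Lemma range_matched_projection x :
  P (matched_projection Q x) = (2^-1)%:C *: (P x + C (Q x)).
Proof.
have -> : matched_projection Q x = (2^-1)%:C *:
    (S (C (S x + Q x - U (S x + Q x))) + adjoint Q (C (S x + Q x - U (S x + Q x)))).
  rewrite matched_projectionE !fctE /= (opB bC) (opB bS) (opB (bounded_adjoint bQ)).
  by congr (_ *: _); rewrite opprD addrACA.
rewrite (opZ bP) (opD bP) PS PQs PC; congr (_ *: _).
by rewrite SC -(CS (_ - _)) -(opD bC) SE (opD bC) CS.
Qed.

Lemma compress_matched_projection x : C x =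
  2%:C *: P (matched_projection Q (P x)) - P x.
Proof.
rewrite range_matched_projection scalerA -rmorphM/= divff ?pnatr_eq0// scale1r.
by rewrite QP PP CP addrC addKr.
Qed.

Lemma idempotent_matched_projection x : Q x =
  2%:C *: S (P (matched_projection Q x)) - S (P x).
Proof.
rewrite range_matched_projection (opZ bS) scalerA -rmorphM/= divff ?pnatr_eq0//.
by rewrite scale1r (opD bS) SC PQ addrC addKr.
Qed.
End PolarData.
End Idempotents.

(** * Auxiliary operators of an idempotent inside a given algebra *)

Section Existence.
Context {R : realType} {H : hilbertType R}.
Implicit Types (x y z : H) (Q P S C U T B : H -> H) (A : set (H -> H)).

(* With R the adjoint of Q, the self-adjoint operator F = Q + R - 1 satisfies
   F^2 = 1 + (R - Q)(Q - R) >= 1, hence is invertible; F^2 commutes with Q and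
   R, and the range projection of Q is Q F^-1 = Q R F^-2. *)
Lemma polar_data_ex A Q : cstar_algebra A -> A Q -> Q \o Q = Q ->
  exists P S C U, [/\ A P, A S, A C, A U & polar_data Q P S C U].
Proof.
move=> hA AQ QQ'; have bQ := cstar_bounded hA AQ.
have AQs := cstar_adjoint hA AQ; have bQs := cstar_bounded hA AQs.
set Qs := adjoint Q in AQs bQs *.
have QQ x : Q (Q x) = Q x := eq_at QQ' x.
have adjQ x y : rdot (Q x) y = rdot x (Qs y) by exact: rdot_adjoint.
have adjQs x y : rdot (Qs x) y = rdot x (Q y) by rewrite rdotC -adjQ rdotC.
have QsQs x : Qs (Qs x) = Qs x.
  by apply: rdot_inj => z; rewrite !adjQs QQ.
pose D := Q \o Qs; have AD : A D by exact: cstarM.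
have pD : positive_op D.
  apply/positive_opP; split; first exact: cstar_bounded AD.
    by move=> x y; rewrite /= adjQ adjQs.
  by move=> x; rewrite /= adjQ rdot_ge0.
pose T := (Qs - Q) \o (Q - Qs).
have AT : A T by apply: (cstarM hA); apply: (cstarB hA).
have bT := cstar_bounded hA AT.
have TE x : T x = Qs (Q x) - Qs x - Q x + Q (Qs x).
  rewrite /T /= !fctE (opB bQ) (opB bQs) QQ QsQs.
  by apply: rdot_inj => z; rewrite !rdotE; ring.
have pT : positive_op T.
  have TN x y : rdot (T x) y = rdot (Q x - Qs x) (Q y - Qs y).
    have -> : T x = Qs (Q x - Qs x) - Q (Q x - Qs x) by [].
    by rewrite [LHS]rdotDl rdotNl adjQs adjQ -rdotNr -rdotDr.
  apply/positive_opP; split=> // [x y|x]; last by rewrite TN rdot_ge0.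
  by rewrite TN rdotC -TN rdotC.
clearbody T.
have [V AV [VT1 VT2 cV]] := resolvent hA AT pT.
have bV := cstar_bounded hA AV.
have VQ : commute_op Q V.
  apply: cV => // x; rewrite !TE !(opD bQ) !(opN bQ) !QQ.
  by apply: rdot_inj => z; rewrite !rdotE; ring.
have VQs : commute_op Qs V.
  apply: cV => // x; rewrite !TE !(opD bQs) !(opN bQs) !QsQs.
  by apply: rdot_inj => z; rewrite !rdotE; ring.
have sV x y : rdot (V x) y = rdot x (V y).
  have inv u : (u - V u) + T (u - V u) = u.
    rewrite (opB bT); apply: rdot_inj => z; rewrite !rdotE.
    by have := congr1 (fun v => rdot v z) (VT1 u); rewrite rdotDl; lra.
  have /positive_opP[_ sT _] := pT.
  have : rdot (x - V x) y = rdot x (y - V y).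
    transitivity (rdot (x - V x) (y - V y) + rdot (x - V x) (T (y - V y))).
      by rewrite -rdotDr inv.
    by rewrite -sT -rdotDl inv.
  by rewrite !rdotE; lra.
have VD x : V (D x) = D (V x) by rewrite /D /= -VQ -VQs.
pose P := D - (D \o V).
have PE x : P x = D x - D (V x) by [].
have AP : A P by apply: (cstarB hA) => //; exact: (cstarM hA).
clearbody P.
have bP := cstar_bounded hA AP; have bD := cstar_bounded hA AD.
have /positive_opP[_ sD _] := pD.
have aP : adjoint P = P.
  by apply/(self_adjointP bP) => x y; rewrite !PE !rdotE !sD sV VD.
have PQ : P \o Q = Q.
  apply/funext => x /=; rewrite PE -VQ.
  (* Together with [T Q = Q T] this reads [D Q = Q (1 + T)]; since [1 - V] inverts [1 + T] and
     commutes with [Q], [P Q = D (1 - V) Q = Q]. *)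
  have DQ y : D (Q y) = Q y + T (Q y).
    rewrite /D TE !QQ; apply: rdot_inj => z; rewrite !rdotE /=; ring.
  have TQ y : T (Q y) = Q (T y).
    rewrite !TE !(opD bQ) !(opN bQ) !QQ.
    by apply: rdot_inj => z; rewrite !rdotE; ring.
  by rewrite !DQ !TQ -!(opD bQ) VT1 (opD bQ) addrK.
have QP : Q \o P = P.
  by apply/funext => x /=; rewrite !PE (opB bQ) /D /= !QQ.
have [S AS [pS SS cS]] := positive_sqrt hA AD pD.
have bS := cstar_bounded hA AS.
have SP x : S (P x) = S x := eq_at (sqrt_range pS SS bQ bP aP PQ) x.
have SV : commute_op V S by apply: cS.
have PV x : V (P x) = P (V x) by rewrite !PE (opB bV) !VD.
(* As [P = S^2 (1 - V)] and [V] commutes with [S], the product [S (1 - V)] inverts [S] relative to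
   [P]; no further limit is taken. *)
pose C := S - (S \o V); have CE x : C x = S x - S (V x) by [].
have AC : A C by apply: (cstarB hA) => //; exact: (cstarM hA).
clearbody C.
have SSE x : S (S x) = D x := eq_at SS x.
have [U AU [SU US _]] := resolvent hA AS pS.
exists P, S, C, U; split=> //; split=> //.
- by split=> //; [exact: cstar_bounded AC|exact: cstar_bounded AU].
- by apply/funext => x /=; rewrite CE (opB bS) !SSE PE.
- by apply/funext => x /=; rewrite CE SV !SSE PE.
- by apply/funext => x /=; rewrite !CE PV !SP.
- exact/funext.
- exact/funext.
Qed.

(** If [Q] is a contraction, so is [adjoint Q]. For [y = P x], [<adjoint Q y, y> = <y, Q y> = |y|^2]
    then forces [adjoint Q y = y]; the adjoint of [(adjoint Q) P = P] is [P Q = P], whence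
    [Q = P]. *)
Lemma nonprojection_opnorm_gt1 Q : nonprojection_idempotent Q -> 1 < opnorm Q.
Proof.
move=> [[bQ QQ] nQ]; rewrite ltNge; apply/negP => Q1; apply: nQ.
have [P [S [C [U [_ _ _ _ hQ]]]]] := polar_data_ex cstar_bounded_op bQ QQ.
have [[_ bP _ _] aP PQ QP _ _ _ _ _ _ _] := hQ.
have Qle x : nrm (Q x) <= nrm x.
  by apply: le_trans (nrm_opnorm x bQ) _; rewrite -[leRHS]mul1r ler_wpM2r ?nrm_ge0.
have bQs := bounded_adjoint bQ.
have Qsle x : nrm (adjoint Q x) <= nrm x.
  have := cauchy_schwarz x (Q (adjoint Q x)); have := Qle (adjoint Q x).
  rewrite ler_norml [rdot x (Q _)]rdotC rdot_adjoint// -nrm_sqr => h /andP[_].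
  have := nrm_ge0 (adjoint Q x); have := nrm_ge0 x.
  nra.
have QsP x : adjoint Q (P x) = P x.
  apply/eqP; rewrite -subr_eq0; apply/eqP/rdot_eq0/eqP.
  rewrite eq_le rdot_ge0 andbT.
  have : rdot (adjoint Q (P x)) (P x) = rdot (P x) (P x).
    by rewrite rdotC -rdot_adjoint// -[Q (P x)]/((Q \o P) x) QP.
  have : nrm (adjoint Q (P x)) ^+ 2 <= nrm (P x) ^+ 2.
    by rewrite ler_sqr ?nnegrE ?nrm_ge0.
  by rewrite !nrm_sqr !rdotE (rdotC (P x) (adjoint Q (P x))); lra.
have QeP : Q = P.
  rewrite -PQ -[LHS](adjointK (boundedM bP bQ)) adjointM// aP.
  by have -> : adjoint Q \o P = P by apply/funext.
by split; [split|rewrite QeP aP].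
Qed.
End Existence.

(** * Generated C*-algebras and transport along morphisms *)

Section Generated.
Context {R : realType} {H : hilbertType R}.
Variables (A : set (H -> H)) (Q : H -> H).
Hypotheses (hA : cstar_algebra A) (AQ : A Q).

Lemma cstar_generated_self : cstar_generated Q Q.
Proof. by move=> B [_ QB]; exact: QB. Qed.

(** The closure properties pass to an intersection; boundedness requires one actual member of the
    family, which is [A]. *)
Lemma cstar_generated_cstar : cstar_algebra (cstar_generated Q).
Proof.
split.
- move=> T gT; apply: (cstar_bounded hA); apply: (gT A); split=> // _ ->.
  exact: AQ.
- split=> [B [hB _]|S T gS gT B hB]; first exact: cstar0.
  by apply: (cstarD hB.1); [exact: gS|exact: gT].
- split=> [c T gT B hB|S T gS gT B hB].
    by apply: (cstarZ hB.1); exact: gT.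
  by apply: (cstarM hB.1); [exact: gS|exact: gT].
- by move=> T gT B hB; apply: (cstar_adjoint hB.1); exact: gT.
- move=> T bT h B hB; case: (hB) => -[_ _ _ _ lim] _; apply: lim => // e /h[S gS Se].
  by exists S => //; exact: gS.
Qed.
End Generated.

Section Transport.
Context {R : realType} {H K : hilbertType R}.
Variables (A : set (H -> H)) (B : set (K -> K)) (phi : (H -> H) -> (K -> K)).
Hypotheses (hA : cstar_algebra A) (hB : cstar_algebra B).
Hypothesis hphi : cstar_morphism A B phi.

Lemma morphism_bounded T : A T -> bounded_op (phi T).
Proof. by case: hphi => h _ _ _ _ AT; apply: (cstar_bounded hB); exact: h. Qed.

Lemma morphismB S T : A S -> A T -> phi (S - T) = phi S - phi T.
Proof.
case: hphi => _ hD hZ _ _ AS AT.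
rewrite -scaleN1r hD//; last exact: (cstarZ hA).
by rewrite hZ// scaleN1r.
Qed.

(** The square root [S] of [T] lies in [A], so [phi T] is the square of the self-adjoint operator
    [phi S]. *)
Lemma morphism_positive T : A T -> positive_op T -> positive_op (phi T).
Proof.
move=> AT pT; have [S AS [/positive_opP[bS sS _] <- _]] := positive_sqrt hA AT pT.
case: (hphi) => _ _ _ hM hadj; rewrite hM//.
have bS' := morphism_bounded AS.
have sS' : forall x y, rdot (phi S x) y = rdot x (phi S y).
  apply/(self_adjointP bS'); rewrite -hadj//; congr phi.
  exact/(self_adjointP bS).
apply/positive_opP; split; first exact: boundedM.
  by move=> x y /=; rewrite !sS'.
by move=> x /=; rewrite sS' rdot_ge0.
Qed.

Lemma morphism_polar_data Q P S C U : A Q -> A P -> A S -> A C -> A U ->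
  polar_data Q P S C U -> polar_data (phi Q) (phi P) (phi S) (phi C) (phi U).
Proof.
move=> AQ AP AS AC AU [_ aP PQ QP pS SS SC CS CP SU US].
case: (hphi) => _ hD _ hM hadj.
split.
- by split; exact: morphism_bounded.
- by rewrite -hadj ?aP.
- by rewrite -hM ?PQ.
- by rewrite -hM ?QP.
- exact: morphism_positive.
- rewrite -hadj// -hM// SS hM//; exact: (cstar_adjoint hA).
- by rewrite -hM ?SC.
- by rewrite -hM ?CS.
- by rewrite -hM ?CP.
- by rewrite -hM// -hD ?SU//; exact: (cstarM hA).
- by rewrite -hM// -hD ?US//; exact: (cstarM hA).
Qed.
End Transport.

Theorem proposition3p10 (R : realType) (r : R) (H : hilbertType R)
    (A : set (H -> H)) (Q : H -> H)
    (hA : cstar_algebra A) (hAQ : A Q)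
    (hQ : nonprojection_idempotent Q) (hr : opnorm Q = r) :
  universal_idempotent r Q <->
  (forall (K : hilbertType R) (B : set (K -> K)) (Q' : K -> K),
     cstar_algebra B -> B Q' ->
     nonprojection_idempotent Q' -> opnorm Q' <= r ->
     exists pi : (H -> H) -> (K -> K),
       [/\ cstar_morphism (cstar_generated Q) (cstar_generated Q') pi,
           pi (matched_projection Q) = matched_projection Q' &
           pi (range_projection Q) = range_projection Q']).
Proof.
have hG := cstar_generated_cstar hA hAQ; have GQ := @cstar_generated_self _ _ Q.
have [P [S [C [U [GP GS GC GU dQ]]]]] := polar_data_ex hG GQ hQ.1.2.
set G := cstar_generated Q in hG GQ GP GS GC GU *.
have GSQs : G (S + adjoint Q).
  by apply: (cstarD hG) => //; exact: (cstar_adjoint hG).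
have GSQ : G (S + Q) by exact: (cstarD hG).
have GSC : G ((S + adjoint Q) \o C) by exact: (cstarM hG).
have GSCU : G ((S + adjoint Q) \o C \o U) by exact: (cstarM hG).
have G1 : G ((S + adjoint Q) \o C \o (S + Q)) by exact: (cstarM hG).
have G2 : G ((S + adjoint Q) \o C \o U \o (S + Q)) by exact: (cstarM hG).
have GM : G (matched_projection Q).
  by rewrite (matched_projectionE dQ); apply: (cstarZ hG); exact: (cstarB hG).
split=> [[_ _ _ univ]|hpi].
  move=> K B Q' hB BQ' nQ' Q'r.
  have [pi [mpi piQ]] := univ K B Q' hB BQ' nQ' Q'r; exists pi.
  have hG' := cstar_generated_cstar hB BQ'.
  (* The images under [pi] satisfy the relations for [pi Q = Q'], so the formulas for the two
     projections of [Q'] can be written with them. *)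
  have dQ' := morphism_polar_data hG hG' mpi GQ GP GS GC GU dQ.
  rewrite piQ in dQ'; split=> //; last first.
    by rewrite (range_projectionE dQ) (range_projectionE dQ').
  rewrite (matched_projectionE dQ) (matched_projectionE dQ').
  case: (mpi) => _ hD hZ hM hadj.
  rewrite hZ; last exact: (cstarB hG).
  rewrite (morphismB hG mpi) ?(hM _ _ GSC GSQ) ?(hM _ _ GSCU GSQ)//.
  rewrite (hM _ _ GSC GU) (hM _ _ GSQs GC) (hD _ _ GS GQ).
  by rewrite (hD _ _ GS (cstar_adjoint hG GQ)) (hadj _ GQ) piQ.
split=> //; first by rewrite -hr; exact: nonprojection_opnorm_gt1.
move=> K B Q' hB BQ' nQ' Q'r.
have [pi [mpi piM piP]] := hpi K B Q' hB BQ' nQ' Q'r; exists pi; split=> //.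
have hG' := cstar_generated_cstar hB BQ'.
(* Here [pi Q] is still unknown, so the operators attached to [Q'] are constructed independently and
   then compared with the images. *)
have [P' [S' [C' [U' [GP' GS' GC' GU' dQ']]]]] :=
  polar_data_ex hG' (@cstar_generated_self _ _ Q') nQ'.1.2.
rewrite (range_projectionE dQ) (range_projectionE dQ') in piP.
set M := matched_projection Q in GM piM; set M' := matched_projection Q' in piM.
case: (mpi) => _ hD hZ hM _.
have GPM : G (P \o M) by exact: (cstarM hG).
have GPMP : G (P \o M \o P) by exact: (cstarM hG).
have piC : pi C = C'.
  have -> : C = 2%:C *: (P \o M \o P) - P.
    by apply/funext => x; rewrite (compress_matched_projection dQ).
  have -> : C' = 2%:C *: (P' \o M' \o P') - P'.
    by apply/funext => x; rewrite (compress_matched_projection dQ').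
  rewrite (morphismB hG mpi)//; last exact: (cstarZ hG).
  by rewrite (hZ _ _ GPMP) (hM _ _ GPM GP) (hM _ _ GP GM) piP piM.
have piSP : pi S \o P' = pi S.
  rewrite -piP -hM//; congr pi; apply/funext => x; exact: (polar_SP dQ).
(* Relative inverses are unique: [pi S = pi S P' = pi S C' S' = P' S' = S']. *)
have piS : pi S = S'.
  have piSC : pi S \o C' = P' by rewrite -piC -hM// (polar_SC dQ).
  rewrite -piSP -(polar_CS dQ') -[LHS]/((pi S \o C') \o S') piSC.
  apply/funext => x; exact: (polar_PS dQ').
have -> : Q = 2%:C *: (S \o (P \o M)) - (S \o P).
  by apply/funext => x; rewrite [LHS](idempotent_matched_projection dQ).
have -> : Q' = 2%:C *: (S' \o (P' \o M')) - (S' \o P').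
  by apply/funext => x; rewrite [LHS](idempotent_matched_projection dQ').
have GSPM : G (S \o (P \o M)) by exact: (cstarM hG).
have GSP : G (S \o P) by exact: (cstarM hG).
rewrite (morphismB hG mpi)//; last exact: (cstarZ hG).
rewrite (hZ _ _ GSPM) (hM _ _ GS GPM) (hM _ _ GP GM) (hM _ _ GS GP).
by rewrite piP piM piS.
Qed.
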